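(* Let $(X,A,W)$ be a complete convex $A$-metric space with convex structure $W$, where $A: X^t\to\mathbb{R}$, and let $f:X\to X$ be an $AZ$ mapping. For $i=1,2,\dots,t$ let $\{\alpha_i^n\}_{n\ge 0}$ be sequences in $[0,1]$ with $\sum_{i=1}^t \alpha_i^n=1$ for all $n\in\mathbb{N}=\{0,1,2,\dots\}$, with $\sum_{n=0}^\infty \alpha_t^n=\infty$, and such that there is a real number $\alpha$ with $0<\alpha\le\alpha_t^n$ for all $n\in\mathbb{N}$. Let $x_0\in X$ and let $\{x_n\}$ be the sequence defined by the Mann iteration process $$x_{n+1}=W\left(x_n,x_n,\dots,x_n,fx_n;\alpha_1^n,\alpha_2^n,\dots,\alpha_t^n\right),\qquad n\in\mathbb{N}.$$ Then this Mann iteration process is $f$-stable.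
   Context: Fix an integer $t\ge 2$ and let $I=[0,1]$. **$A$-metric space.** Let $X$ be a nonempty set. $(X,A)$ is an $A$-metric space if $A:X^t\to\mathbb{R}$ satisfies, for all $x_1,\dots,x_t,y\in X$: (A1) $A(x_1,\dots,x_t)\ge 0$; (A2) $A(x_1,\dots,x_t)=0$ if and only if $x_1=x_2=\dots=x_t$; (A3) $A(x_1,x_2,\dots,x_t)\le \sum_{i=1}^t A(x_i,x_i,\dots,x_i,y)$, where in each term on the right $x_i$ fills the first $t-1$ slots and $y$ the last slot. Throughout, $A(x,x,\dots,x,y)$ denotes the value of $A$ with $x$ in the first $t-1$ slots and $y$ in the last slot. **Convergence and completeness.** A sequence $\{x_n\}$ in $X$ converges to $u\in X$ (written $\lim_{n\to\infty}x_n=u$) if $A(x_n,x_n,\dots,x_n,u)\to 0$ as $n\to\infty$. It is Cauchy if $A(x_n,x_n,\dots,x_n,x_m)\to 0$ as $n,m\to\infty$. $(X,A)$ is complete if every Cauchy sequence in $X$ converges to a point of $X$. **Convex structure.** A mapping $W:X^t\times I^t\to X$ is a convex structure on $(X,A)$ if $$A\bigl(u_1,\dots,u_{t-1},W(x_1,\dots,x_t;a_1,\dots,a_t)\bigr)\le \sum_{i=1}^t a_i\,A(u_1,\dots,u_{t-1},x_i)$$ for all $a_1,\dots,a_t\in I$ with $\sum_{i=1}^t a_i=1$, and all $u_1,\dots,u_{t-1},x_1,\dots,x_t\in X$. An $A$-metric space with a convex structure $W$ is called a convex $A$-metric space, written $(X,A,W)$; it is complete if $(X,A)$ is complete. **$AZ$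 mapping ($A$-Zamfirescu mapping).** A map $f:X\to X$ is an $AZ$ mapping if there are real numbers $a,b,c$ with $0\le a<1$ and $0\le b,c<\frac1t$ such that for all $x,y\in X$ at least one of the following holds: (AZ1) $A(fx,\dots,fx,fy)\le a\,A(x,\dots,x,y)$; (AZ2) $A(fx,\dots,fx,fy)\le b\,[A(fx,\dots,fx,x)+A(fy,\dots,fy,y)]$; (AZ3) $A(fx,\dots,fx,fy)\le c\,[A(fx,\dots,fx,y)+A(fy,\dots,fy,x)]$. **$f$-stability.** Let $f:X\to X$ and suppose the Mann iteration $x_{n+1}=W(x_n,\dots,x_n,fx_n;\alpha_1^n,\dots,\alpha_t^n)$ started at $x_0$ converges to a fixed point $u$ of $f$. For an arbitrary sequence $\{y_n\}_{n\ge0}$ in $X$ set $$\epsilon_n=A\bigl(y_{n+1},y_{n+1},\dots,y_{n+1},g(f,y_n)\bigr),\qquad g(f,y_n)=W\left(y_n,y_n,\dots,y_n,fy_n;\alpha_1^n,\alpha_2^n,\dots,\alpha_t^n\right),\qquad n=0,1,2,\dots$$ The Mann iteration process is called $f$-stable (stable with respect to $f$) if, for every sequence $\{y_n\}$ in $X$, $$\lim_{n\to\infty}\epsilon_n=0\iff \lim_{n\to\infty}y_n=u.$$ (For an $AZ$ mapping on a complete convex $A$-metric space, with $\sum_n\alpha_t^n=\infty$, the iteration converges to the unique fixed point $u$ of $f$, so the definition applies.) *)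

(* Defs.v *)
From HB Require Import structures.
From mathcomp Require Import all_boot all_order all_algebra.
From mathcomp Require Import all_classical all_reals all_analysis.

Set Implicit Arguments.
Unset Strict Implicit.
Unset Printing Implicit Defensive.

Import Order.TTheory GRing.Theory Num.Theory numFieldNormedType.Exports.

Local Open Scope classical_set_scope.
Local Open Scope ring_scope.

(* A t-tuple over X is a function 'I_t -> X. We write t = s.+1, so that the
   slots 1, ..., t - 1 are the images of 'I_s and the last slot is ord_max. *)

(* (u_1, ..., u_s, w) *)
Definition snoc (T : Type) (s : nat) (u : 'I_s -> T) (w : T) : 'I_s.+1 -> T :=
  fun i => if unlift ord_max i is Some j then u j else w.

(* (x, ..., x, y) *)
Definition repl (T : Type) (s : nat) (x y : T) : 'I_s.+1 -> T :=
  snoc (fun=> x) y.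

Definition is_A_metric (R : realType) (s : nat) (X : Type)
    (A : ('I_s.+1 -> X) -> R) : Prop :=
  [/\ forall x, 0 <= A x,
      forall x, A x = 0 <-> (forall i j, x i = x j)
    & forall x y, A x <= \sum_i A (repl (x i) y)].

Definition A_cvg (R : realType) (s : nat) (X : Type)
    (A : ('I_s.+1 -> X) -> R) (x : nat -> X) (u : X) : Prop :=
  A (repl (x n) u) @[n --> \oo] --> (0 : R).

Definition A_cauchy (R : realType) (s : nat) (X : Type)
    (A : ('I_s.+1 -> X) -> R) (x : nat -> X) : Prop :=
  A (repl (x nm.1) (x nm.2)) @[nm --> (\oo, \oo)] --> (0 : R).

Definition A_complete (R : realType) (s : nat) (X : Type)
    (A : ('I_s.+1 -> X) -> R) : Prop :=
  forall x : nat -> X, A_cauchy A x -> exists u, A_cvg A x u.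

(* {i01 R} is the type of the elements of R lying in [0, 1]. *)
Definition is_convex_structure (R : realType) (s : nat) (X : Type)
    (A : ('I_s.+1 -> X) -> R)
    (W : ('I_s.+1 -> X) -> ('I_s.+1 -> {i01 R}) -> X) : Prop :=
  forall (a : 'I_s.+1 -> {i01 R}) (u : 'I_s -> X) (x : 'I_s.+1 -> X),
    \sum_i (a i)%:num = 1 ->
    A (snoc u (W x a)) <= \sum_i (a i)%:num * A (snoc u (x i)).

Definition is_AZ (R : realType) (s : nat) (X : Type)
    (A : ('I_s.+1 -> X) -> R) (f : X -> X) : Prop :=
  exists a b c : R,
    [/\ 0 <= a < 1, 0 <= b < 1 / s.+1%:R, 0 <= c < 1 / s.+1%:R
      & forall x y : X,
        [\/ A (repl (f x) (f y)) <= a * A (repl x y),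
            A (repl (f x) (f y))
              <= b * (A (repl (f x) x) + A (repl (f y) y))
          | A (repl (f x) (f y))
              <= c * (A (repl (f x) y) + A (repl (f y) x))]].

Definition mann_step (R : realType) (s : nat) (X : Type)
    (W : ('I_s.+1 -> X) -> ('I_s.+1 -> {i01 R}) -> X) (f : X -> X)
    (alpha : nat -> 'I_s.+1 -> {i01 R}) (n : nat) (y : X) : X :=
  W (repl y (f y)) (alpha n).

Fixpoint mann (R : realType) (s : nat) (X : Type)
    (W : ('I_s.+1 -> X) -> ('I_s.+1 -> {i01 R}) -> X) (f : X -> X)
    (alpha : nat -> 'I_s.+1 -> {i01 R}) (x0 : X) (n : nat) : X :=
  if n is m.+1 then mann_step W f alpha m (mann W f alpha x0 m) else x0.

(* Convergence of the iteration to a fixed point u, which the definition of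
   stability presupposes, is part of the predicate; such a u is unique because
   A-limits are. *)
Definition mann_stable (R : realType) (s : nat) (X : Type)
    (A : ('I_s.+1 -> X) -> R)
    (W : ('I_s.+1 -> X) -> ('I_s.+1 -> {i01 R}) -> X) (f : X -> X)
    (alpha : nat -> 'I_s.+1 -> {i01 R}) (x0 : X) : Prop :=
  exists u : X,
    [/\ f u = u,
        A_cvg A (mann W f alpha x0) u
      & forall y : nat -> X,
          A (repl (y n.+1) (mann_step W f alpha n (y n))) @[n --> \oo]
            --> (0 : R)
          <-> A_cvg A y u].

(* Main.v *)
Require Import Defs.
From HB Require Import structures.
From mathcomp Require Import all_boot all_order all_algebra.
From mathcomp Require Import all_classical all_reals all_analysis.
From mathcomp Require Import lra.

(** Write [t = s.+1] and [d x y = A (x, ..., x, y)]. Taking all but one point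
    equal in (A3) shows that [d] is symmetric and satisfies the lopsided
    triangle inequality [d x z <= s * d x y + d z y]; only one of the two legs
    is inflated by [s], so chaining many small steps costs a single factor [s].

    For an AZ map, (AZ2) and (AZ3) bound [P = d (f x) (f y)] by [k * Q], where
    the lopsided inequality gives [Q <= q + s * P] for a suitable [q] free of
    [f y]. Since [k < 1 / (s + 1)], the term [k * s * P] can be absorbed on the
    left, and [P <= k / (1 - k * s) * q] with ratio less than 1
    ([AZ_absorb]). This makes [f] contract its own steps, and contract up to a
    multiple of [d x (f x)] ([AZ_estimates]). Hence Picard iterates are Cauchy
    and their limit [u] is fixed ([picard_fixed_point]), and
    [d u (f y) <= del * d u y] for all [y], with [del < 1].

    Convexity turns the last estimate into [d u (g y) <= q * d u y] for every
    Mann step [g], with the uniform ratio [q = 1 - a * (1 - del) < 1], [a]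
    being the lower bound of the weights of [f y]. If [e n] is the error made
    at step [n], then [d (y n.+1) u <= q * d (y n) u + s * e n], and such a
    perturbed contraction tends to 0 when the errors do
    ([perturbed_contraction_cvg0]). The converse is the lopsided triangle
    inequality through [u]. The Mann iteration itself is the error-free
    sequence, so its convergence is a case of its stability. *)

Set Implicit Arguments.
Unset Strict Implicit.
Unset Printing Implicit Defensive.

Import Order.TTheory GRing.Theory Num.Theory numFieldNormedType.Exports.

Local Open Scope classical_set_scope.
Local Open Scope ring_scope.

(** * Real sequences *)

(** Once [e n <= (1 - q) * (eps / 2)], the value [eps / 2] is a supersolution of
    the recursion, so the excess of [r] over it decays geometrically. *)
Lemma perturbed_contraction_cvg0 (R : realType) (q : R) (r e : nat -> R) :
    0 <= q < 1 -> (forall n, 0 <= r n) ->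
    (forall n, r n.+1 <= q * r n + e n) ->
  e n @[n --> \oo] --> 0 -> r n @[n --> \oo] --> 0.
Proof.
move=> /andP[q0 q1] r0 rS e0; apply/cvgrPdist_lt => eps eps0.
have h0 : 0 < (1 - q) * (eps / 2) by rewrite mulr_gt0 ?subr_gt0 ?divr_gt0.
move/cvgrPdist_lt : e0 => /(_ _ h0) [N _ eN].
have rN k : r (N + k)%N <= q ^+ k * r N + eps / 2.
  elim: k => [|k IH]; first by rewrite addn0 expr0 mul1r lerDl ltW ?divr_gt0.
  rewrite addnS exprS; have := rS (N + k)%N.
  have := eN (N + k)%N (leq_addr _ _); rewrite /= sub0r normrN.
  move=> /(le_lt_trans (ler_norm _)) => He.
  by have := ler_wpM2l q0 IH; lra.
have /cvgrPdist_lt : (q ^+ k * r N @[k --> \oo] --> 0).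
  rewrite -[0](mul0r (r N)); apply: cvgMr_tmp.
  by apply: cvg_expr; rewrite ger0_norm.
move=> /(_ (eps / 2)); rewrite divr_gt0// => /(_ isT)[M _ qM].
exists (N + M)%N => // n /= NMn; rewrite sub0r normrN ger0_norm//.
have Nn : (N <= n)%N by exact: leq_trans (leq_addr _ _) NMn.
have := qM (n - N)%N; rewrite /= leq_subRL// => /(_ NMn).
rewrite sub0r normrN => /(le_lt_trans (ler_norm _)).
by have := rN (n - N)%N; rewrite subnKC//; lra.
Qed.


Lemma cvg_scale0 (R : realType) (k : R) (v : nat -> R) :
  v n @[n --> \oo] --> 0 -> k * v n @[n --> \oo] --> 0.
Proof. by move=> v0; rewrite -[X in _ --> X](mulr0 k); exact: cvgMl_tmp. Qed.

Lemma cvg_lin0 (R : realType) (k : R) (v w : nat -> R) :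
    v n @[n --> \oo] --> 0 -> w n @[n --> \oo] --> 0 ->
  k * v n + w n @[n --> \oo] --> 0.
Proof.
move=> v0 w0; rewrite -[X in _ --> X](addr0 (0 : R)).
by apply: cvgD => //; exact: cvg_scale0.
Qed.

(** * The two-point function of an A-metric *)

Lemma repl_max (T : Type) (s : nat) (x y : T) : repl x y (@ord_max s) = y.
Proof. by rewrite /repl /snoc unlift_none. Qed.

Lemma repl_neq_max (T : Type) (s : nat) (x y : T) (i : 'I_s.+1) :
  i != ord_max -> repl x y i = x.
Proof.
rewrite eq_sym /repl /snoc => /unlift_some[j _ h].
by rewrite h.
Qed.

Section AMetric.
Context (R : realType) (s : nat) (X : Type) (A : ('I_s.+1 -> X) -> R).
Hypothesis A_metric : is_A_metric A.
Implicit Types x y z u : X.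

Lemma dist_ge0 x y : 0 <= A (repl x y).
Proof. by case: A_metric. Qed.

Lemma distxx x : A (repl x x) = 0.
Proof.
case: A_metric => _ A0 _; apply/A0 => i j.
have rE k : @repl X s x x k = x.
  by have [->|kmax] := eqVneq k ord_max; rewrite (repl_max, repl_neq_max).
by rewrite !rE.
Qed.

(** This is (A3) at the tuple [(x, ..., x, z)]. Whichever leg is more convenient
    can carry the factor [s], which the later arguments exploit. *)
Lemma dist_triangle x y z :
  A (repl x z) <= s%:R * A (repl x y) + A (repl z y).
Proof.
case: A_metric => _ _ /(_ (repl x z) y) /le_trans; apply.
rewrite (bigD1 ord_max)//= repl_max addrC lerD2r.
rewrite (eq_bigr (fun=> A (repl x y))); last first.
  by move=> i imax; rewrite repl_neq_max.
by rewrite sumr_const cardC1 card_ord mulr_natl.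
Qed.

(** In [dist_triangle] with [y := x] the inflated leg [d x x] vanishes. *)
Lemma dist_sym x y : A (repl x y) = A (repl y x).
Proof.
apply/eqP; rewrite eq_le; apply/andP; split.
  by have := dist_triangle x x y; rewrite distxx mulr0 add0r.
by have := dist_triangle y y x; rewrite distxx mulr0 add0r.
Qed.

Lemma dist_eq0 x y : (0 < s)%N -> A (repl x y) = 0 -> x = y.
Proof.
move=> s0; case: A_metric => _ A0 _ /A0 /(_ ord0 ord_max).
by rewrite repl_max repl_neq_max// -val_eqE /= eq_sym -lt0n.
Qed.

(** The factor [s] of the triangle inequality is put on the first, already
    geometric, step of each chain; the rest of the chain keeps coefficient 1,
    so the powers of [s] do not accumulate. *)
Lemma geometric_steps_cauchy (x : nat -> X) (q : R) : 0 <= q < 1 ->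
    (forall n, A (repl (x n.+1) (x n.+2)) <= q * A (repl (x n) (x n.+1))) ->
  A_cauchy A x.
Proof.
move=> /andP[q0 q1] xq; pose C := s%:R * A (repl (x 0) (x 1)) / (1 - q).
have q1' : 0 < 1 - q by rewrite subr_gt0.
have step n : A (repl (x n) (x n.+1)) <= q ^+ n * A (repl (x 0) (x 1)).
  elim: n => [|n IH]; first by rewrite expr0 mul1r.
  by rewrite exprS -mulrA (le_trans (xq n))// ler_wpM2l.
have CE : s%:R * A (repl (x 0) (x 1)) = C * (1 - q) by rewrite divfK ?gt_eqF.
have C0 : 0 <= C by rewrite divr_ge0 ?mulr_ge0 ?dist_ge0// ltW.
have tail k : forall n, A (repl (x n) (x (n + k)%N)) <= C * q ^+ n.
  elim: k => [|k IH] n; first by rewrite addn0 distxx mulr_ge0 ?exprn_ge0.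
  apply: (le_trans (dist_triangle _ (x n.+1) _)).
  rewrite [A (repl (x (_ + _)%N) _)]dist_sym addnS -addSn.
  (* C is the solution of the recursion s * d (x 0) (x 1) + q * C = C, which the
     induction on the length of the chain needs. *)
  have := ler_wpM2l (ler0n R s) (step n).
  rewrite mulrCA CE; have := IH n.+1; rewrite exprS.
  by set a := A _; set b := A _; lra.
have qcvg : C * q ^+ n @[n --> \oo] --> 0.
  by apply: cvg_scale0; apply: cvg_expr; rewrite ger0_norm.
have bound n m : A (repl (x n) (x m)) <= C * q ^+ n + C * q ^+ m.
  have Cq k : 0 <= C * q ^+ k by rewrite mulr_ge0 ?exprn_ge0.
  have [nm|/ltnW mn] := leqP n m.
    by rewrite -(subnKC nm) (le_trans (tail _ _))// lerDl.
  by rewrite dist_sym -(subnKC mn) (le_trans (tail _ _))// lerDr.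
apply: (@squeeze_cvgr _ _ _ _ (fun=> 0)
  (fun nm : nat * nat => C * q ^+ nm.1 + C * q ^+ nm.2)).
- by apply: nearW => nm; rewrite dist_ge0 bound.
- exact: cvg_cst.
- rewrite -[X in _ --> X](addr0 (0 : R)); apply: cvgD.
    exact: (cvg_comp _ _ cvg_fst qcvg).
  exact: (cvg_comp _ _ cvg_snd qcvg).
Qed.

(** All but the last argument of the convex combination equal [y], so their
    weights add up to one minus the last one. *)
Lemma dist_mann_step (W : ('I_s.+1 -> X) -> ('I_s.+1 -> {i01 R}) -> X)
    (f : X -> X) (alpha : nat -> 'I_s.+1 -> {i01 R}) (n : nat) u y :
    is_convex_structure A W -> \sum_i (alpha n i)%:num = 1 :> R ->
  A (repl u (mann_step W f alpha n y)) <=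
    (1 - (alpha n ord_max)%:num) * A (repl u y)
    + (alpha n ord_max)%:num * A (repl u (f y)).
Proof.
move=> W_convex alpha1.
apply: (le_trans (W_convex (alpha n) (fun=> u) (repl y (f y)) alpha1)).
rewrite -[in leRHS]alpha1 (bigD1 ord_max)//= repl_max.
rewrite [in leRHS](bigD1 ord_max)//= addrAC subrr add0r addrC lerD2r mulr_suml.
by apply: ler_sum => i imax; rewrite repl_neq_max.
Qed.

(** * Zamfirescu mappings *)

(** The three alternatives of an AZ map are reduced to one conclusion, with [q]
    left free: each application picks the [q] for which the two sums can be
    bounded by triangle inequalities. The bound [1 / t] on [b]
    and [c] is exactly what makes the ratio [k / (1 - k * s)] less than 1. *)
Lemma AZ_absorb (f : X -> X) : is_AZ A f ->
  exists2 del : R, 0 <= del < 1 & forall x y q,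
    A (repl x y) <= q ->
    A (repl (f x) x) + A (repl (f y) y) <= q + s%:R * A (repl (f x) (f y)) ->
    A (repl (f x) y) + A (repl (f y) x) <= q + s%:R * A (repl (f x) (f y)) ->
    A (repl (f x) (f y)) <= del * q.
Proof.
move=> [a [b [c [/andP[a0 a1] /andP[b0 b1] /andP[c0 c1] faz]]]].
pose k := Num.max b c.
have bk : b <= k by rewrite le_max lexx.
have ck : c <= k by rewrite le_max lexx orbT.
have k0 : 0 <= k := le_trans b0 bk.
have k1 : k * s%:R + k < 1.
  have : k < 1 / s.+1%:R by rewrite gt_max b1 c1.
  by rewrite ltr_pdivlMr// -[s.+1%:R]natr1 mulrDr mulr1.
have ks : 0 < 1 - k * s%:R by lra.
exists (Num.max a (k / (1 - k * s%:R))).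
  rewrite le_max a0 /= gt_max a1 /= ltr_pdivrMr//; lra.
move=> x y q xq fxq fyq.
have q0 : 0 <= q := le_trans (dist_ge0 x y) xq.
have absorb l r : 0 <= l <= k -> 0 <= r ->
    r <= q + s%:R * A (repl (f x) (f y)) -> A (repl (f x) (f y)) <= l * r ->
    A (repl (f x) (f y)) <= Num.max a (k / (1 - k * s%:R)) * q.
  move=> /andP[l0 lk] r0 rq flr.
  apply: (@le_trans _ _ (k / (1 - k * s%:R) * q)); last first.
    by rewrite ler_wpM2r// le_max lexx orbT.
  rewrite mulrAC ler_pdivlMr//.
  have := ler_wpM2l k0 rq; have := ler_wpM2r r0 lk.
  lra.
case: (faz x y) => H.
- apply: (le_trans H); apply: ler_pM => //; first exact: dist_ge0.
  by rewrite le_max lexx.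
- by apply: absorb H; rewrite ?b0 ?addr_ge0 ?dist_ge0.
- by apply: absorb H; rewrite ?c0 ?addr_ge0 ?dist_ge0.
Qed.

(** The first estimate is not a case of the second one, whose coefficient
    [del * (2 + s)] at [y := f x] can exceed 1; it comes from a smaller [q].
    The second one, at a fixed point [x], is a genuine contraction to [x]. *)
Lemma AZ_estimates (f : X -> X) : (0 < s)%N -> is_AZ A f ->
  exists del : R, [/\ 0 <= del < 1,
    forall x, A (repl (f x) (f (f x))) <= del * A (repl x (f x))
  & forall x y, A (repl (f x) (f y))
      <= del * (A (repl x y) + (1 + s%:R) * A (repl x (f x)))].
Proof.
move=> s0 /AZ_absorb[del del01 fdel]; exists del.
have s1 : 1 <= s%:R :> R by rewrite ler1n.
split=> // [x|x y]; apply: fdel => //.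
- rewrite [A (repl (f (f x)) _)]dist_sym [A (repl (f x) x)]dist_sym lerD2l.
  by rewrite ler_peMl ?dist_ge0.
- rewrite distxx add0r addrC [A (repl (f x) _)]dist_sym.
  exact: dist_triangle.
- by rewrite lerDl mulr_ge0 ?addr_ge0 ?dist_ge0.
- have := dist_triangle (f y) (f x) y.
  have := dist_triangle y x (f x).
  rewrite [A (repl y (f x))]dist_sym [A (repl (f y) (f x))]dist_sym.
  rewrite [A (repl y x)]dist_sym [A (repl (f x) x)]dist_sym.
  have := dist_triangle (f x) x y.
  rewrite [A (repl (f x) x)]dist_sym [A (repl y x)]dist_sym.
  set P := s%:R * A (repl (f _) (f y)).
  lra.
- have := dist_triangle (f y) (f x) x.
  have := dist_triangle (f x) x y.
  rewrite [A (repl (f y) (f x))]dist_sym [A (repl y x)]dist_sym.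
  rewrite [A (repl (f x) x)]dist_sym.
  set P := s%:R * A (repl (f _) (f y)).
  lra.
Qed.

(** The limit [u] of the Picard iterates [x n] of [x0] is fixed because the
    second estimate at [x n] and [u] compares [x n.+1] with [f u] through
    quantities that all tend to 0. *)
Lemma picard_fixed_point (f : X -> X) (del : R) x0 :
    (0 < s)%N -> A_complete A -> 0 <= del < 1 ->
    (forall x, A (repl (f x) (f (f x))) <= del * A (repl x (f x))) ->
    (forall x y, A (repl (f x) (f y))
      <= del * (A (repl x y) + (1 + s%:R) * A (repl x (f x)))) ->
  exists u, f u = u.
Proof.
move=> s0 A_compl del01 f_step f_lip.
have [del0 del1] := andP del01.
pose x n := iter n f x0.
have [|u xu] := A_compl x.
  by apply: (geometric_steps_cauchy del01) => n; exact: f_step.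
have xS : A (repl (x n.+1) u) @[n --> \oo] --> 0.
  by move: xu; rewrite /A_cvg -(cvg_shiftS (fun n => A (repl (x n) u))).
exists u.
pose D n := s%:R * A (repl (x n) u) + A (repl (x n.+1) u).
pose q n := A (repl (x n) u) + (1 + s%:R) * D n.
have bound n : A (repl (f u) u) <= s%:R * (del * q n) + A (repl (x n.+1) u).
  have xD : A (repl (x n) (f (x n))) <= D n := dist_triangle _ _ _.
  apply: (le_trans (dist_triangle _ (x n.+1) _)).
  rewrite [A (repl u _)]dist_sym [A (repl (f u) _)]dist_sym lerD2r.
  rewrite ler_wpM2l// (le_trans (f_lip (x n) u))// ler_wpM2l// lerD2l.
  by rewrite ler_wpM2l// addr_ge0.
apply: dist_eq0 => //; apply/eqP; rewrite eq_le dist_ge0 andbT.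
have D0 : D n @[n --> \oo] --> 0 by exact: cvg_lin0.
have q0 : q n @[n --> \oo] --> 0.
  rewrite -[X in _ --> X](addr0 (0 : R)); apply: cvgD => //.
  exact: cvg_scale0.
have lim : s%:R * (del * q n) + A (repl (x n.+1) u) @[n --> \oo] --> 0.
  by apply: cvg_lin0 => //; exact: cvg_scale0.
exact: (ler_cvg_to (cvg_cst _) lim (nearW _ bound)).
Qed.

End AMetric.

(** * Stability of the Mann iteration *)

Theorem theorem2p2 (R : realType) (s : nat) (t_ge2 : (2 <= s.+1)%N) (X : Type)
    (A : ('I_s.+1 -> X) -> R)
    (W : ('I_s.+1 -> X) -> ('I_s.+1 -> {i01 R}) -> X)
    (A_metric : is_A_metric A) (A_compl : A_complete A)
    (W_convex : is_convex_structure A W)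
    (f : X -> X) (f_AZ : is_AZ A f)
    (alpha : nat -> 'I_s.+1 -> {i01 R})
    (alpha_sum1 : forall n, \sum_i (alpha n i)%:num = 1 :> R)
    (alpha_div : (\sum_(0 <= n <oo) ((alpha n ord_max)%:num : R)%:E = +oo)%E)
    (alpha_lb : exists a : R, 0 < a /\ forall n, a <= (alpha n ord_max)%:num)
    (x0 : X) :
  mann_stable A W f alpha x0.
Proof.
have s0 : (0 < s)%N by [].
have [a [a0 alpha_ge]] := alpha_lb.
have [del [del01 f_step f_lip]] := AZ_estimates A_metric s0 f_AZ.
have [u fu] := picard_fixed_point A_metric x0 s0 A_compl del01 f_step f_lip.
have fdel y : A (repl u (f y)) <= del * A (repl u y).
  by have := f_lip u y; rewrite fu (distxx A_metric) mulr0 addr0.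
have /andP[del0 del1] := del01.
(* The ratio of the Mann step, worst when the weight of f y is smallest. *)
pose q := 1 - a * (1 - del).
have q01 : 0 <= q < 1.
  have a1 : a <= 1 by apply: le_trans (alpha_ge 0%N) _.
  by rewrite /q; nra.
have step n y : A (repl u (mann_step W f alpha n y)) <= q * A (repl u y).
  apply: (le_trans (dist_mann_step _ _ _ W_convex (alpha_sum1 n))).
  have := fdel y; have := dist_ge0 A_metric u y; have := alpha_ge n.
  move: (alpha n ord_max)%:num (A (repl u y)) (A (repl u (f y))).
  move=> p d e ap d0 de.
  have p0 : 0 <= p by apply: le_trans ap; exact: ltW.
  have := ler_wpM2l p0 de.
  have : a * ((1 - del) * d) <= p * ((1 - del) * d).
    by rewrite ler_wpM2r// mulr_ge0// subr_ge0 ltW.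
  rewrite /q; lra.
have stable y :
    A (repl (y n.+1) (mann_step W f alpha n (y n))) @[n --> \oo] --> (0 : R) ->
  A_cvg A y u.
  move=> eps0; apply: (perturbed_contraction_cvg0 q01 (e := fun n =>
    s%:R * A (repl (y n.+1) (mann_step W f alpha n (y n))))).
  - by move=> n; exact: dist_ge0.
  - move=> n; rewrite addrC.
    apply: le_trans.
      exact: (dist_triangle A_metric _ (mann_step W f alpha n (y n)) _).
    by rewrite lerD2l (dist_sym A_metric (y n)).
  - exact: cvg_scale0.
exists u; split=> //.
  (* The Mann iterates follow the scheme without error. *)
  apply: stable; rewrite (_ : (fun n => _) = fun=> 0); first exact: cvg_cst.
  by apply/funext => n; exact: distxx.
move=> y; split; first exact: stable.
move=> yu.
have yS : A (repl (y n.+1) u) @[n --> \oo] --> 0.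
  by move: yu; rewrite /A_cvg -(cvg_shiftS (fun n => A (repl (y n) u))).
apply: (@squeeze_cvgr _ _ _ _ (fun=> 0)
  (fun n => s%:R * A (repl (y n.+1) u) + q * A (repl (y n) u))).
- apply: nearW => n; rewrite dist_ge0//=.
  apply: (le_trans (dist_triangle A_metric _ u _)).
  by rewrite lerD2l (dist_sym A_metric) (dist_sym A_metric (y n)).
- exact: cvg_cst.
- by apply: cvg_lin0 => //; exact: cvg_scale0.
Qed.
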